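(* Let $(X,\tau,\mathfrak{a})$ be a transitive $\mathfrak{a}$-space, let $(x_n)_{n\in\mathbb{N}}$ be a sequence in $X$ and let $x\in X$. Then $(x_n)$ $\mathfrak{a}$-converges to $x$ if and only if there exists $N\in\mathbb{N}$ such that $x_n\in\mathfrak{a}(x)$ for all $n\geq N$.
   Context: An aura topological space (or $\mathfrak{a}$-space) $(X,\tau,\mathfrak{a})$ is a topological space $(X,\tau)$ together with a function $\mathfrak{a}:X\to\tau$ (a scope function) such that $x\in\mathfrak{a}(x)$ for every $x\in X$. It is transitive if $y\in\mathfrak{a}(x)$ implies $\mathfrak{a}(y)\subseteq\mathfrak{a}(x)$ for all $x,y\in X$. A subset $A\subseteq X$ is $\mathfrak{a}$-open if $\mathfrak{a}(x)\subseteq A$ for every $x\in A$; the collection $\tau_{\mathfrak{a}}$ of all $\mathfrak{a}$-open sets is a topology on $X$ with $\tau_{\mathfrak{a}}\subseteq\tau$. A sequence $(x_n)$ in $X$ $\mathfrak{a}$-converges to $x\in X$ if for every $U\in\tau_{\mathfrak{a}}$ with $x\in U$ there exists $N\in\mathbb{N}$ such that $x_n\in U$ for all $n\geq N$. *)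

(* Defs.v *)
From mathcomp Require Import all_boot.
From mathcomp Require Import boolp classical_sets topology.

Set Implicit Arguments.
Unset Strict Implicit.
Unset Printing Implicit Defensive.

Local Open Scope classical_set_scope.

(* A map into the topology is encoded as a set-valued map with open values. *)
Record scope_function (X : topologicalType) := ScopeFunction {
  scope :> X -> set X;
  scope_open : forall x, open (scope x);
  scope_mem : forall x, scope x x
}.

Definition aura_transitive (X : topologicalType) (a : scope_function X) : Prop :=
  forall x y : X, a x y -> a y `<=` a x.

Definition aura_open (X : topologicalType) (a : scope_function X) : set_system X :=
  [set A : set X | forall x, A x -> a x `<=` A].

Definition aura_converges (X : topologicalType) (a : scope_function X)
    (u : nat -> X) (x : X) : Prop :=
  forall U : set X, aura_open a U -> U x ->
    exists N : nat, forall n : nat, N <= n -> U (u n).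

(* Main.v *)
Require Import Defs.
From mathcomp Require Import all_boot.
From mathcomp Require Import boolp classical_sets topology.

Theorem theorem3p17 (X : topologicalType) (a : scope_function X)
    (a_trans : aura_transitive a) (u : nat -> X) (x : X) :
  aura_converges a u x <->
  exists N : nat, forall n : nat, N <= n -> a x (u n).
Proof.
split=> [ux | [N uN] U Uopen Ux].
  (* By transitivity [a x] is itself aura-open, hence the least aura-open neighbourhood of [x]. *)
  by apply: ux; [exact: a_trans | exact: scope_mem].
(* Aura-openness of [U], applied at the point [x] itself, gives the inclusion of [a x] in [U]. So
   the set [a x] alone is a neighbourhood base at [x] for the aura-open sets, and the one index [N]
   past which the sequence stays in [a x] serves every such [U]. *)
by exists N => n Nn; apply: (Uopen x Ux); exact: uN.
Qed.
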